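(* Let $T=(V,E,r)$ be a finite, connected, rooted tree with root $r$ and weight index $\eta=\eta(T)$. Then for every positive integer $k$, $$\ell_T(k)\le 2\binom{2\eta+k}{k}.$$
   Context: Graphs are finite, simple and undirected. For a graph $G=(V,E)$ and $S\subseteq V$, the edge boundary is $\delta(S,G)=\{(u,v)\in E: u\in S,\ v\in V-S\}$, the set of edges with exactly one endpoint in $S$. For an integer $i$ with $1\le i\le |V|$, the edge isoperimetric value of $G$ at $i$ is $b_e(i,G)=\min_{S\subseteq V,\ |S|=i}|\delta(S,G)|$. For a positive integer $k$, $\ell_G(k)=|\{i\in\mathbb{N}: 1\le i\le |V|,\ b_e(i,G)\le k\}|$. For a rooted tree $T=(V,E,r)$, write $u\preceq_T v$ if $u$ lies on the path from the root $r$ to $v$ (in particular $u\preceq_T u$). The weight of a vertex $u$ is $w_T(u)=|\{v\in V: u\preceq_T v\}|$, the number of successors of $u$ including $u$ itself. The weight index of $T$ is the number of distinct weights, $\eta(T)=|\{w_T(u):u\in V\}|$. *)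

(* Defs.v *)
From mathcomp Require Import all_boot.

Set Implicit Arguments.
Unset Strict Implicit.
Unset Printing Implicit Defensive.

(* A simple graph with vertex set the finite type V is given by its adjacency
   relation e : rel V. *)

Definition simple_graph (V : finType) (e : rel V) : Prop :=
  symmetric e /\ irreflexive e.

Definition connected_graph (V : finType) (e : rel V) : Prop :=
  forall x y : V, connect e x y.

(* [:: x; y] is a ucycle as soon as x and y are adjacent, so the graph-theoretic
   cycles are the ucycles of length at least 3. *)
Definition acyclic_graph (V : finType) (e : rel V) : Prop :=
  forall c : seq V, 2 < size c -> ~ ucycle e c.

Definition is_tree (V : finType) (e : rel V) : Prop :=
  [/\ simple_graph e, connected_graph e & acyclic_graph e].

(* Every edge with exactly one endpoint in S is counted once, oriented from its
   endpoint in S to its endpoint outside S. *)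
Definition edge_boundary (V : finType) (e : rel V) (S : {set V}) : {set V * V} :=
  [set p | [&& e p.1 p.2, p.1 \in S & p.2 \notin S]].

(* The unit #|V * V| of the minimum bounds the size of every edge boundary, so
   it is irrelevant as soon as some S has cardinal i (see edge_isoP). *)
Definition edge_iso (V : finType) (e : rel V) (i : nat) : nat :=
  \big[minn/#|{: V * V}|]_(S : {set V} | #|S| == i) #|edge_boundary e S|.

Definition ell (V : finType) (e : rel V) (k : nat) : nat :=
  #|[set i : 'I_#|V|.+1 | (1 <= i) && (edge_iso e i <= k)]|.

(* u lies on a simple path from r to v; the bound on the length n only serves
   to make the predicate boolean (see tree_leP). *)
Definition tree_le (V : finType) (e : rel V) (r u v : V) : bool :=
  [exists n : 'I_#|V|, exists p : n.-tuple V,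
     [&& path e r p, uniq (r :: p), last r p == v & u \in r :: p]].

Definition weight (V : finType) (e : rel V) (r u : V) : nat :=
  #|[set v | tree_le e r u v]|.

Definition weight_index (V : finType) (e : rel V) (r : V) : nat :=
  size (undup [seq weight e r u | u : V]).

Lemma tree_leP (V : finType) (e : rel V) (r u v : V) :
  reflect (exists p : seq V,
             [/\ path e r p, uniq (r :: p), last r p = v & u \in r :: p])
          (tree_le e r u v).
Proof.
apply: (iffP existsP) => [[n /existsP[p /and4P[rp Up /eqP pv up]]]|].
  by exists p.
case=> p [rp Up pv up].
have ltp : size p < #|V| by rewrite -[_.+1]/(size (r :: p)) -(card_uniqP Up) max_card.
exists (Ordinal ltp); apply/existsP; exists (in_tuple p).
by apply/and4P; split=> //; apply/eqP.
Qed.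

Lemma edge_isoP (V : finType) (e : rel V) (i : nat) : i <= #|V| ->
  (exists2 S : {set V}, #|S| = i & #|edge_boundary e S| = edge_iso e i) /\
  (forall S : {set V}, #|S| = i -> edge_iso e i <= #|edge_boundary e S|).
Proof.
move=> lei.
have lb (S : {set V}) : #|S| = i -> edge_iso e i <= #|edge_boundary e S|.
  move=> cS; rewrite /edge_iso.
  elim: (index_enum _) (mem_index_enum S) => //= S' s IHs.
  rewrite inE big_cons => /predU1P[<-|/IHs le_s]; first by rewrite cS eqxx geq_minl.
  by case: ifP => // _; rewrite geq_min le_s orbT.
split=> //.
have [S0 cS0] : exists S : {set V}, #|S| = i.
  exists [set x in take i (enum V)].
  rewrite cardsE (card_uniqP _) ?take_uniq ?enum_uniq //.
  by rewrite size_takel // -cardE.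
have [S /eqP cS minS] :=
  @arg_minnP _ S0 (fun S => #|S| == i) (fun S => #|edge_boundary e S|) (introT eqP cS0).
exists S => //; apply/eqP; rewrite eqn_leq lb // andbT /edge_iso.
by elim/big_ind: _ => [|x y lx ly|]; rewrite ?max_card // leq_min lx.
Qed.

(* Main.v *)
Require Import Defs.
From mathcomp Require Import all_boot all_algebra.

(** Root the tree at [r] and write [par u] for the parent of [u].  Summing a
    function [f] on the vertices along root paths telescopes: [f v] is [f r] plus
    the increments [f u - f (par u)] over the vertices [u] of the path from [r]
    to [v].  Summing over [v], each increment at [u] is counted once for each
    successor of [u], that is [weight u] times ([sum_weights]).

    For [f] the indicator of a vertex set [S], the increments are 0, 1 or -1,
    and the nonzero ones sit at the lower endpoints of the boundary edges of
    [S].  Hence if [S] has at most [k] boundary edges, then [#|S|] is 0 or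
    [#|V|], plus a sum of at most [k] integers taken among the [2 * eta] numbers
    [w] and [- w], for [w] a weight ([card_signed_weights]).  Allowing 0 as a
    further summand makes this a sum of exactly [k] terms among [2 * eta + 1]
    values.  The order of the terms does not matter, so each of the two choices
    of the first term leads to at most as many sums as there are sorted
    [k]-tuples over [2 * eta + 1] symbols, namely ['C(2 * eta + k, k)]
    ([card_offset_sums]). *)

Set Implicit Arguments.
Unset Strict Implicit.
Unset Printing Implicit Defensive.

Import GRing.Theory.

(** * Simple paths in a tree *)

(** If the two paths branch off at [x], towards [a] and [b], then their tails
    connect [a] to [b] without meeting [x], and [x] closes a cycle. *)
Lemma simple_path_unique (V : finType) (e : rel V) (x : V) (p q : seq V) :
  symmetric e -> acyclic_graph e ->
  path e x p -> uniq (x :: p) -> path e x q -> uniq (x :: q) ->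
  last x p = last x q -> p = q.
Proof.
move=> e_sym acy; elim: p x q => [|a p IHp] x [|b q] //=.
- by move=> _ _ _ /andP[xq _] eqx; rewrite eqx mem_last in xq.
- by move=> _ /andP[xp _] _ _ eqx; rewrite -eqx mem_last in xp.
move=> /andP[xa ap] /andP[xNp Up] /andP[xb bq] /andP[xNq Uq] eq_last.
case: (eqVneq a b) => [eqab | neqab].
  by rewrite -eqab in bq Uq eq_last *; rewrite (IHp a q).
pose e' := [rel u v | [&& e u v, u != x & v != x]].
have e'_sym : symmetric e' by move=> u v; rewrite /= e_sym; do 2 case: (_ == x).
have conn c s : path e c s -> x \notin c :: s -> connect e' c (last c s).
  move=> cs xNs; apply/connectP; exists s => //.
  elim: s c cs xNs => //= d s IHs c /andP[cd ds].
  rewrite !inE !negb_or => /and3P[xc xd xs].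
  by rewrite cd ![_ == x]eq_sym xc xd IHs // inE negb_or xd.
have /connectP[s0 ps0 lasts0] : connect e' a b.
  apply: connect_trans (conn _ _ ap xNp) _.
  by rewrite eq_last (sym_connect_sym e'_sym) conn.
case/shortenP: ps0 lasts0 => s ps Us _ lasts.
have ps' : path e a s by apply: sub_path ps => u v /= /and3P[].
have xNs : x \notin a :: s.
  rewrite inE negb_or; apply/andP; split.
    by apply: contra xNp => /eqP->; rewrite mem_head.
  elim: s (a) ps {Us lasts ps'} => //= d s IHs c /andP[/and3P[_ _ dx] ds].
  by rewrite inE negb_or eq_sym dx (IHs d).
case: (acy (x :: a :: s)).
  by case: s lasts {ps Us ps' xNs} => // eqba; rewrite eqba eqxx in neqab.
by rewrite /ucycle /= rcons_path xa ps' -lasts e_sym xb xNs.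
Qed.

Lemma root_paths (V : finType) (e : rel V) (r : V) : connected_graph e ->
  exists P : V -> seq V,
    forall v, [/\ path e r (P v), uniq (r :: P v) & last r (P v) = v].
Proof.
move=> conn; suff /fin_all_exists[P PP] v : exists p : seq V,
    [/\ path e r p, uniq (r :: p) & last r p = v] by exists P.
have /connectP[p0 rp0 lastp0] := conn r v.
by case/shortenP: rp0 lastp0 => p rp Up _ lastp; exists p; split.
Qed.

(** * Sums over the vertices as weighted sums of increments *)

(** The convention [par r = r] makes the increment at the root vanish, so that
    the sum can range over all the vertices.  The second clause is the only
    trace of acyclicity that [par] needs to keep: no edge is traversed upwards
    from both of its endpoints. *)
Lemma sum_weights (V : finType) (e : rel V) (r : V) : is_tree e ->
  exists par : V -> V,
    [/\ par r = r, forall u, par (par u) = u -> u = r,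
        forall u, u != r -> e (par u) u
      & forall f : V -> int,
          (\sum_v f v = f r *+ #|V|
                        + \sum_u (f u - f (par u)) *+ weight e r u)%R].
Proof.
move=> [[e_sym _] conn acy]; have [P PP] := root_paths r conn.
have P_last p : path e r p -> uniq (r :: p) -> P (last r p) = p.
  move=> rp Up; have [rP UP lastP] := PP (last r p).
  exact: simple_path_unique lastP.
have Pr : P r = [::] by rewrite -[r in P r]/(last r [::]) P_last.
(* The vertex before the last one on the path from r, or r if there is none. *)
pose par u := nth r (r :: P u) (size (P u)).-1.
have P_par u : u != r -> P u = rcons (P (par u)) u /\ e (par u) u.
  have [] := PP u; rewrite /par; case/lastP: (P u) => [|p z].
    by move=> _ _ /= ->; rewrite eqxx.
  rewrite last_rcons rcons_path -rcons_cons rcons_uniq size_rcons /=.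
  rewrite -rcons_cons nth_rcons /= ltnS leqnn -last_nth.
  by move=> /andP[rp pz] /andP[_ Up] <- _; rewrite P_last.
have par_r : par r = r by rewrite /par Pr.
exists par; split=> // [u par2 | u /P_par[] // | f].
  apply/eqP/negP=> /negP ur; have [Pu _] := P_par u ur.
  case: (eqVneq (par u) r) => [parur | /P_par[]].
    by rewrite -par2 parur par_r eqxx in ur.
  rewrite par2 Pu => /(congr1 size); rewrite !size_rcons => /eqP.
  by rewrite -addn2 -[X in X == _]addn0 eqn_add2l.
have telescope p : path e r p -> uniq (r :: p) ->
    (f (last r p) = f r + \sum_(u <- p) (f u - f (par u)))%R.
  elim/last_ind: p => [|p u IHp] rpu Upu; first by rewrite big_nil addr0.
  have Pu : P u = rcons p u by rewrite -[u in P u](last_rcons r p u) P_last.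
  have paru : par u = last r p.
    rewrite /par Pu size_rcons -rcons_cons nth_rcons /= ltnS leqnn.
    by rewrite -last_nth.
  move: rpu Upu; rewrite rcons_path -rcons_cons rcons_uniq.
  move=> /andP[rp _] /andP[_ Up].
  rewrite last_rcons -cats1 big_cat big_seq1 /= addrA -(IHp rp Up) paru.
  by rewrite addrC subrK.
have tree_leE u v : tree_le e r u v = (u \in r :: P v).
  have [rP UP lastP] := PP v.
  apply/tree_leP/idP => [[p [rp Up <- up]] | up]; first by rewrite P_last.
  by exists (P v).
have increments v :
    (f v = f r + \sum_(u | tree_le e r u v) (f u - f (par u)))%R.
  have [rP UP lastP] := PP v; rewrite -[in LHS]lastP telescope //; congr (_ + _)%R.
  transitivity (\sum_(u <- r :: P v) (f u - f (par u)))%R.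
    by rewrite big_cons par_r subrr add0r.
  by rewrite big_uniq //=; apply: eq_bigl => u; rewrite tree_leE.
rewrite (eq_bigr _ (fun v _ => increments v)) big_split /= sumr_const.
congr (_ + _)%R; rewrite (exchange_big_dep predT) //=; apply: eq_bigr => u _.
by rewrite sumr_const /weight cardsE.
Qed.

Definition signed_weights (V : finType) (e : rel V) (r : V) : seq int :=
  let ws := undup [seq weight e r u | u : V] in
  [seq w%:Z%R | w : nat <- ws] ++ [seq (- w%:Z)%R | w : nat <- ws].

(** Each vertex with a nonzero increment is charged to the edge towards its
    parent, which lies in the boundary. *)
Lemma card_signed_weights (V : finType) (e : rel V) (r : V) (S : {set V}) :
  is_tree e ->
  exists s : seq int,
    [/\ size s <= #|edge_boundary e S|, {subset s <= signed_weights e r}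
      & (#|S|%:Z = (if r \in S then #|V|%:Z else 0) + \sum_(z <- s) z)%R].
Proof.
move=> htree; have [[e_sym _] _ _] := htree.
have [par [par_r par2 par_edge sumE]] := sum_weights r htree.
pose f u : int := Posz (u \in S).
pose D := [set u | (u \in S) != (par u \in S)].
exists [seq ((f u - f (par u)) *+ weight e r u)%R | u <- enum D]; split.
- rewrite size_map -cardE.
  pose edge u := if u \in S then (u, par u) else (par u, u).
  rewrite -(card_in_imset (f := edge)); last first.
    (* Only opposite orientations can collide, which would make two vertices
       the parents of each other. *)
    have nomutual u v : u \in D -> u = par v -> par u = v -> u = v.
      move=> uD uv vu; suff ur : u = r by rewrite -vu ur par_r.
      by apply: par2; rewrite vu.
    move=> u v uD vD; rewrite /edge; case: ifP => _; case: ifP => _ [] //.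
      exact: nomutual.
    by move=> vu uv; apply: nomutual.
  apply/subset_leq_card/subsetP => p /imsetP[u]; rewrite inE => uD ->{p}.
  have ur : u != r by apply: contraNneq uD => ->; rewrite par_r.
  have := par_edge u ur; rewrite inE /edge.
  case: ifP uD => uS /=; rewrite uS; case: (par u \in S) => //= _.
    by rewrite e_sym => ->.
  by move=> ->.
- move=> z /mapP[u]; rewrite mem_enum inE /f => uD ->.
  have wu : weight e r u \in undup [seq weight e r u | u : V].
    by rewrite mem_undup image_f.
  rewrite mem_cat; apply/orP; case: (u \in S) (par u \in S) uD => [] [] // _.
    by left; rewrite subr0 natz map_f.
  by right; rewrite sub0r mulNrn natz; apply: map_f (fun w : nat => - w%:Z)%R _ _ _.
have fS : (\sum_v f v = #|S|%:Z)%R.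
  rewrite -sum1_card -natz natr_sum [RHS]big_mkcond.
  by apply: eq_bigr => v _; rewrite /f; case: (v \in S).
rewrite -fS sumE big_map big_enum; congr (_ + _)%R.
  by rewrite /f; case: (r \in S); rewrite ?natz // mul0rn.
rewrite [RHS]big_mkcond; apply: eq_bigr => u _; rewrite inE /f.
by case: eqP => //= ->; rewrite subrr mul0rn.
Qed.

(** * Counting sums of few terms *)

(** A sum does not depend on the order of its terms, so it is determined by a
    sorted tuple of positions in [vals]. *)
Lemma card_offset_sums (R : nmodType) (I : finType) (A : {set I}) (h : I -> R)
    (c : bool -> R) (vals : seq R) (k : nat) :
  injective h ->
  (forall i, i \in A -> exists b (s : seq R),
    [/\ size s <= k, {subset s <= vals} & (h i = c b + \sum_(z <- s) z)%R]) ->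
  #|A| <= 2 * 'C(size vals + k, k).
Proof.
move=> h_inj AP; set N := size vals.
(* The last index N is past the end of vals: it stands for the default value 0
   and pads the shorter sums to length k. *)
pose value (j : 'I_N.+1) := nth 0%R vals j.
pose total (q : bool * k.-tuple 'I_N.+1) := (c q.1 + \sum_(j <- q.2) value j)%R.
pose sorted_tuples :=
  [set t : k.-tuple 'I_N.+1 | sorted leq [seq val j | j <- t]].
have /fin_all_exists[F FP] i : exists q : bool * k.-tuple 'I_N.+1,
    i \in A -> q.2 \in sorted_tuples /\ h i = total q.
  case: (boolP (i \in A)) => [/AP[b [s [les s_vals ->]]] | _]; last first.
    by exists (false, [tuple ord0 | _ < k]).
  pose t0 : seq 'I_N.+1 :=
    [seq inord (index z vals) | z <- s] ++ nseq (k - size s) ord_max.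
  pose t := sort (relpre val leq) t0.
  have szt : size t == k by rewrite size_sort size_cat size_map size_nseq subnKC.
  exists (b, Tuple szt) => _; split.
    by rewrite inE sorted_map sort_sorted // => x y; apply: leq_total.
  rewrite /total /=; congr (_ + _)%R.
  rewrite [RHS](perm_big t0) ?perm_sort //= big_cat big_map /=.
  rewrite [X in (_ + X)%R]big_nseq iter_addr_0 /value nth_default //.
  rewrite mul0rn addr0 !big_seq; apply: eq_bigr => z /s_vals zv.
  by rewrite inordK ?nth_index // ltnS index_size.
have F_inj : {in A &, injective F}.
  move=> i j /FP[_ hi] /FP[_ hj] eqF; apply: h_inj.
  by rewrite hi hj eqF.
rewrite -(card_in_imset F_inj) addnC -card_sorted_tuples -card_bool -cardsT -cardsX.
apply/subset_leq_card/subsetP => q /imsetP[i iA ->].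
by case: (F i) (FP i iA) => b t [t_sorted _]; rewrite in_setX in_setT.
Qed.

Theorem theorem1 (V : finType) (e : rel V) (r : V) (k : nat)
  (htree : is_tree e) (hk : 0 < k) :
  ell e k <= 2 * 'C(2 * weight_index e r + k, k).
Proof.
have <- : size (signed_weights e r) = 2 * weight_index e r.
  by rewrite size_cat !size_map mul2n addnn.
apply: (@card_offset_sums _ _ _ (fun i : 'I_#|V|.+1 => Posz i)
          (fun b : bool => if b then Posz #|V| else 0%R)).
  by move=> i j [/val_inj].
move=> i; rewrite inE => /andP[_ lek].
have [[S cardS isoS] _] := edge_isoP e (leq_ord i).
have [s [les s_vals sumS]] := card_signed_weights r S htree.
exists (r \in S), s; split=> //; last by rewrite -cardS.
by rewrite (leq_trans les) // isoS.
Qed.
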